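(* Let $X_0$ be a Banach space and $A:D(A)\to X_0$ a (not necessarily densely defined) linear operator with $0\in\rho(A)$ such that $D(\underline{A})$ is dense in $\underline{X}_0$. Then the operator $A_{-1}:X_0\to X_{-1}$ is an extension of $\underline{A}_{-1}:\underline{X}_0\to\underline{X}_{-1}$; $(X_{-1},\|\cdot\|_{X_{-1}})$ is a Banach space; the norms of $\underline{X}_{-1}$ and $X_{-1}$ coincide on $\underline{X}_{-1}$, and $\underline{X}_{-1}$ is a closed subspace of $X_{-1}$. The mapping $A_{-1}:X_0\to X_{-1}$ is an isometric isomorphism.
   Context: $\|\cdot\|$ is the norm of $X_0$; $\underline{X}_0:=\overline{D(A)}$ with norm $\|\cdot\|$; $\underline{A}$ is the part of $A$ in $\underline{X}_0$, i.e. $D(\underline{A})=\{x\in D(A): Ax\in\underline{X}_0\}$. $\underline{X}_{-1}$ is the completion of $X_0$ for the norm $\|x\|_{\underline{X}_{-1}}:=\|A^{-1}x\|$ (under the density assumption it is also a completion of $\underline{X}_0$ for this norm), and $\underline{A}_{-1}:\underline{X}_0\to\underline{X}_{-1}$ is the unique continuous extension of $A:(D(A),\|\cdot\|)\to(X_0,\|\cdot\|_{\underline{X}_{-1}})$; it is an isometric isomorphism. Iterating once, $\underline{X}_{-2}$ is the completion of $\underline{X}_{-1}$ for the norm $\|x\|_{\underline{X}_{-2}}:=\|\underline{A}_{-1}^{-1}x\|_{\underline{X}_{-1}}$, and $\underline{A}_{-2}:\underline{X}_{-1}\to\underline{X}_{-2}$ is the unique continuous extension of $\underline{A}_{-1}:\underline{X}_0\to\underline{X}_{-1}$;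 it is an isometric isomorphism. Thus $\underline{X}_0\subseteq X_0\subseteq\underline{X}_{-1}\subseteq\underline{X}_{-2}$. Define $X_{-1}:=\underline{A}_{-2}(X_0)\subseteq\underline{X}_{-2}$ with $\|x\|_{X_{-1}}:=\|\underline{A}_{-2}^{-1}x\|$, and let $A_{-1}:X_0\to X_{-1}$ be the restriction of $\underline{A}_{-2}$ to $X_0$. *)

(* Defs.v *)
From HB Require Import structures.
From mathcomp Require Import all_boot all_order all_algebra.
From mathcomp Require Import all_classical all_reals all_analysis.
Set Implicit Arguments.
Unset Strict Implicit.
Unset Printing Implicit Defensive.
Import Order.TTheory GRing.Theory Num.Theory.
Import numFieldNormedType.Exports.
Local Open Scope classical_set_scope.
Local Open Scope ring_scope.

(* Partially defined maps are represented by total functions together with a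
   set; the values outside that set are irrelevant. *)

Definition linear_subspace (K : numFieldType) (V : lmodType K) (S : set V) :=
  S 0 /\ forall (a : K) (x y : V), S x -> S y -> S (a *: x + y).

Definition linear_on (K : numFieldType) (V W : lmodType K) (D : set V)
    (f : V -> W) :=
  linear_subspace D /\
  forall (a : K) (x y : V), D x -> D y -> f (a *: x + y) = a *: f x + f y.

(* The inverse of f : D -> f @` D, with junk value 0 outside f @` D. *)
Definition inv_on (K : numFieldType) (V W : lmodType K) (D : set V)
    (f : V -> W) : W -> V :=
  'pinv_(fun=> 0) D f.

Definition resolvent_set (K : numFieldType) (X : normedModType K) (D : set X)
    (A : X -> X) : set K :=
  [set l | set_bij D [set: X] (fun x => l *: x - A x) /\
     exists M : K, forall y : X,
       `|inv_on D (fun x => l *: x - A x) y| <= M * `|y|].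

(* The domain of the part of (D, A) in the subspace S. *)
Definition part_dom (X : Type) (D : set X) (A : X -> X) (S : set X) : set X :=
  [set x | D x /\ S (A x)].

Definition is_completion (K : numFieldType) (V : lmodType K) (p : V -> K)
    (Y : completeNormedModType K) (i : {linear V -> Y}) :=
  (forall x : V, `|i x| = p x) /\ dense (range i).

(* g : E -> U is a continuous extension of f : D -> U, where D is regarded as
   a subset of E through the inclusion j. *)
Definition is_continuous_extension (S : Type) (T U : topologicalType)
    (D : set S) (f : S -> U) (j : S -> T) (E : set T) (g : T -> U) :=
  [/\ j @` D `<=` E, {within E, continuous g} &
      forall x : S, D x -> g (j x) = f x].

Definition is_norm_on (K : numFieldType) (V : lmodType K) (S : set V)
    (p : V -> K) :=
  [/\ forall x, S x -> 0 <= p x,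
      forall x, S x -> p x = 0 -> x = 0,
      forall (a : K) x, S x -> p (a *: x) = `|a| * p x &
      forall x y, S x -> S y -> p (x + y) <= p x + p y].

(* Completeness of the metric space S with distance p (x - y), in terms of
   Cauchy filters (as in the library) rather than sequences. *)
Definition is_complete_for (K : numFieldType) (V : lmodType K) (S : set V)
    (p : V -> K) :=
  forall F : set_system V, ProperFilter F -> F S ->
    (forall e : K, 0 < e -> exists2 x, S x & F [set y | p (x - y) < e]) ->
    exists2 x, S x & forall e : K, 0 < e -> F [set y | p (x - y) < e].

Definition is_Banach_space (K : numFieldType) (V : lmodType K) (S : set V)
    (p : V -> K) :=
  [/\ linear_subspace S, is_norm_on S p & is_complete_for S p].

Definition is_closed_subspace (K : numFieldType) (V : lmodType K)
    (S : set V) (p : V -> K) (T : set V) :=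
  [/\ linear_subspace T, T `<=` S &
      forall x, S x ->
        (forall e : K, 0 < e -> exists2 y, T y & p (x - y) < e) -> T x].

Definition is_isometric_isomorphism (K : numFieldType) (X : normedModType K)
    (V : lmodType K) (S : set V) (p : V -> K) (f : X -> V) :=
  [/\ linear f, set_bij [set: X] S f & forall x, p (f x) = `|x|].

(* In the next two definitions i1 : X0 -> Y1 is the inclusion of X0 in its
   completion Y1, and A2 : Y1 -> Y2 is the extension of A to Y1. *)
Section Xm1.
Context (K : numFieldType) (X0 Y1 Y2 : normedModType K).
Variables (i1 : X0 -> Y1) (A2 : Y1 -> Y2).

Definition Xm1 : set Y2 := A2 @` range i1.

(* The norm of X0 is applied to the inverse image of z under A2, which lies in
   range i1 and is identified with an element of X0. *)
Definition norm_Xm1 (z : Y2) : K :=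
  `|inv_on [set: X0] i1 (inv_on [set: Y1] A2 z)|.

Definition Am1 (x : X0) : Y2 := A2 (i1 x).

End Xm1.

(* Main.v *)
(* A continuous map that is linear and isometric on a subspace E stays so on
   the closure of E, and if the domain is complete and the image of E is dense
   then it maps the closure of E onto the target.  This applies to A1 with
   E = D, because |i1 (A x)| = |x| on D and A maps D onto X0, so that A1 is an
   isometric isomorphism from the closure of D onto Y1.  It then applies to A2
   with E = i1 (closure D), because |i2 (A1 x)| = |i1 x| there; this E is dense
   in Y1, since x = A z can be approximated by A z' with z' in the domain of
   the part of A and |i1 (A z) - i1 (A z')| = |z - z'|.  Hence X_{-1} is X0
   transported along the injective linear map A2 \o i1, and each point of Y1
   corresponds under i2 and A2 \o i1 to a point of closure D, of the same
   norm. *)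
Require Import Defs.
From HB Require Import structures.
From mathcomp Require Import all_boot all_order all_algebra.
From mathcomp Require Import ring.
From mathcomp Require Import all_classical all_reals all_analysis.
Set Implicit Arguments.
Unset Strict Implicit.
Unset Printing Implicit Defensive.
Import Order.TTheory GRing.Theory Num.Theory.
Import numFieldNormedType.Exports.
Local Open Scope classical_set_scope.
Local Open Scope ring_scope.

(** * Closures and approximation in normed spaces *)

Lemma closure_normP (K : numFieldType) (V : normedModType K) (E : set V)
    (x : V) :
  closure E x <-> forall e : K, 0 < e -> exists2 y, E y & `|x - y| < e.
Proof.
split=> [Ex e e0|Ex B /nbhs_normP[e /= e0 xeB]].
  have [y [Ey xy]] := Ex _ (nbhsx_ballx x e e0).
  by exists y => //; move: xy; rewrite -ball_normE.
by have [y Ey xy] := Ex e e0; exists y; split => //; apply: xeB.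
Qed.

Lemma dense_closure (T : topologicalType) (S : set T) :
  dense S -> closure S = [set: T].
Proof.
move=> dS; apply/seteqP; split=> // x _ B; rewrite nbhsE => -[U [oU Ux] UB].
have [y [Uy Sy]] := dS U (ex_intro _ x Ux) oU.
by exists y; split => //; apply: UB.
Qed.

Lemma closure_linear_subspace (K : numFieldType) (V : normedModType K)
    (E : set V) :
  linear_subspace E -> linear_subspace (closure E).
Proof.
move=> [E0 El]; split; first exact: subset_closure.
move=> a x y /closure_normP Ex /closure_normP Ey; apply/closure_normP => e e0.
have c0 : 0 < `|a| + 1 by rewrite ltr_wpDl.
have d0 : 0 < e / 2 / (`|a| + 1) by rewrite !divr_gt0.
have [x' Ex' xx'] := Ex _ d0.
have e20 : 0 < e / 2 by rewrite divr_gt0.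
have [y' Ey' yy'] := Ey _ e20.
exists (a *: x' + y'); first exact: El.
rewrite opprD addrACA -scalerBr (le_lt_trans (ler_normD _ _))// (splitr e).
rewrite ler_ltD// normrZ.
rewrite (le_trans (ler_wpM2l (normr_ge0 _) (ltW xx')))//.
by rewrite mulrA ler_pdivrMr// mulrC ler_wpM2l// ?lerDl// ltW//.
Qed.

Lemma linear_onB (K : numFieldType) (V W : lmodType K) (E : set V)
    (g : V -> W) (x y : V) :
  linear_on E g -> E x -> E y -> E (x - y) /\ g (x - y) = g x - g y.
Proof.
move=> [[_ El] gl] Ex Ey.
have -> : x - y = (-1) *: y + x by rewrite scaleN1r addrC.
by split; [exact: El | rewrite gl// scaleN1r addrC].
Qed.

(** Since [E] lies in [C], continuity within [C] controls [g] at the points of [E] near [x], so a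
    single [x'] serves both estimates. *)
Lemma within_approx (K : numFieldType) (V W : normedModType K) (E C : set V)
    (g : V -> W) :
  closure E = C -> {within C, continuous g} ->
  forall x e, C x -> 0 < e ->
    exists x', [/\ E x', `|x - x'| < e & `|g x - g x'| < e].
Proof.
move=> EC /subspace_continuousP gc x e Cx e0.
have gx : nbhs x [set t | C t -> `|g x - g t| < e].
  by have /cvgrPdist_lt/(_ e e0) := gc x Cx.
have : closure E x by rewrite EC.
move=> /(_ _ (filterI gx (nbhsx_ballx x e e0)))[x' [Ex' [h1 h2]]].
exists x'; split => //; first by move: h2; rewrite -ball_normE.
by apply: h1; rewrite -EC; exact: subset_closure.
Qed.

(** * Isometries on a subspace and their extension to the closure *)

Section extension_of_isometry.
Context (K : numFieldType) (V W : normedModType K) (E C : set V) (g : V -> W).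
Hypotheses (EC : closure E = C) (gc : {within C, continuous g}).
Hypotheses (gl : linear_on E g) (gi : forall x, E x -> `|g x| = `|x|).

(** Phrased with distances instead of norms because linearity of [g] is so far known on [E] only;
    linearity on [C] is deduced from it. *)
Lemma closure_distance x y : C x -> C y -> `|g x - g y| = `|x - y|.
Proof.
move=> Cx Cy; apply/eqP; rewrite -subr_eq0 -normr_le0.
apply/ler_addgt0Pr => e e0; rewrite add0r.
(* Replacing [x], [y] by [x'], [y'] changes each of the two distances, in [V] and in [W], by at most
   [e / 4 + e / 4]. *)
have d0 : 0 < e / 4 by rewrite divr_gt0.
have [x' [Ex' x1 x2]] := within_approx EC gc Cx d0.
have [y' [Ey' y1 y2]] := within_approx EC gc Cy d0.
have [Exy gxy] := linear_onB gl Ex' Ey'.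
have xy : `|g x' - g y'| = `|x' - y'| by rewrite -gxy gi.
have close (U : normedModType K) (u v u' v' : U) : `|u - u'| < e / 4 ->
    `|v - v'| < e / 4 -> `| `|u - v| - `|u' - v'| | <= e / 4 + e / 4.
  move=> uu' vv'; rewrite (le_trans (ler_dist_dist _ _))//.
  have -> : u - v - (u' - v') = (u - u') - (v - v').
    by rewrite !opprB addrACA [RHS]addrACA; congr (_ + _); rewrite addrC.
  by rewrite (le_trans (ler_normB _ _))// lerD// ltW.
have h1 := close _ _ _ _ _ x2 y2.
have h2 := close _ _ _ _ _ x1 y1.
rewrite xy in h1.
rewrite -(subrKA `|x' - y'|) (le_trans (ler_normD _ _))//.
rewrite [X in _ + X]distrC (le_trans (lerD h1 h2))//.
by rewrite le_eqVlt; apply/orP; left; apply/eqP; field.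
Qed.

(** The defect of linearity is compared with the zero defect at nearby points of [E];
    [closure_distance] controls the term [g (a *: x + y)]. *)
Lemma closure_linear_on : linear_on C g.
Proof.
have [Es gl'] := gl.
have Cs : linear_subspace C by rewrite -EC; exact: closure_linear_subspace.
have EsC : E `<=` C by rewrite -EC; exact: subset_closure.
split=> // a x y Cx Cy; apply/eqP; rewrite -subr_eq0 -normr_le0.
apply/ler_addgt0Pr => e e0; rewrite add0r.
have c0 : 0 < `|a| + 1 by rewrite ltr_wpDl.
(* Chosen so that [|a|] times this bound plus the bound itself is [e / 2]; this estimate is used
   once in [V] and once in [W]. *)
have d0 : 0 < e / 2 / (`|a| + 1) by rewrite !divr_gt0.
have [x' [Ex' x1 x2]] := within_approx EC gc Cx d0.
have [y' [Ey' y1 y2]] := within_approx EC gc Cy d0.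
have Exy : E (a *: x' + y') by apply: Es.2.
rewrite -(subrKA (g (a *: x' + y'))) (le_trans (ler_normD _ _))//.
rewrite closure_distance; [|exact: Cs.2|exact: EsC].
rewrite gl'//.
have bound (U : normedModType K) (u v u' v' : U) :
    `|u - u'| < e / 2 / (`|a| + 1) -> `|v - v'| < e / 2 / (`|a| + 1) ->
    `|a *: u + v - (a *: u' + v')| <= e / 2.
  move=> u1 v1; rewrite opprD addrACA -scalerBr.
  rewrite (le_trans (ler_normD _ _))// normrZ.
  rewrite (le_trans (lerD (ler_wpM2l (normr_ge0 _) (ltW u1)) (ltW v1)))//.
  by rewrite -{2}[e / 2 / _]mul1r -mulrDl mulrC divfK// gt_eqF.
by rewrite (splitr e) lerD// bound// distrC.
Qed.

Lemma closure_isometry x : C x -> `|g x| = `|x|.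
Proof.
have [[C0 _] _] := closure_linear_on; move=> Cx.
have g0 : g 0 = 0.
  have [E0 _] := gl.1.
  by apply/eqP; rewrite -normr_eq0 gi ?normr0.
by rewrite -[g x]subr0 -g0 closure_distance ?subr0.
Qed.

Lemma closure_set_inj : set_inj C g.
Proof.
move=> x y; rewrite !inE => Cx Cy gxy; apply/eqP.
by rewrite -subr_eq0 -normr_eq0 -closure_distance// gxy subrr normr0.
Qed.

End extension_of_isometry.

(** The points of [E] that [g] sends close to [w] form a Cauchy filter, because [g] preserves
    distances; its limit is a preimage of [w]. *)
Lemma dense_isometry_surj (K : numFieldType) (V : completeNormedModType K)
    (W : normedModType K) (E C : set V) (g : V -> W) :
  closure E = C -> {within C, continuous g} -> linear_on E g ->
  (forall x, E x -> `|g x| = `|x|) -> dense (g @` E) ->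
  set_surj C [set: W] g.
Proof.
move=> EC gc gl gi /dense_closure gd w _.
pose F := filter_from (nbhs w) (fun B => E `&` g @^-1` B).
have EsC : E `<=` C by rewrite -EC; exact: subset_closure.
have gw B : nbhs w B -> E `&` g @^-1` B !=set0.
  move=> wB; have : closure (g @` E) w by rewrite gd.
  by move=> /(_ _ wB)[_ [[x Ex <-] Bx]]; exists x.
have FF : ProperFilter F.
  apply: filter_from_proper => //; apply: filter_from_filter.
    by exists [set: W]; exact: filterT.
  move=> A B wA wB; exists (A `&` B); first exact: filterI.
  by move=> x [Ex [Ax Bx]].
have Fc : cauchy F.
  apply: cauchy_exP => e e0.
  have e20 : 0 < e / 2 by rewrite divr_gt0.
  have [x [Ex wx]] := gw _ (nbhsx_ballx w _ e20).
  exists x, (ball w (e / 2)); first exact: nbhsx_ballx.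
  move=> y [Ey wy]; rewrite -ball_normE /ball_/=.
  rewrite -(closure_distance EC gc gl gi (EsC _ Ex) (EsC _ Ey)).
  move: wx wy; rewrite -!ball_normE /ball_/= => wx wy.
  rewrite -(subrKA w) (le_lt_trans (ler_normD _ _))// (splitr e).
  by rewrite ltrD// distrC.
have [l Fl] : exists l : V, F --> l by apply/cvg_ex; exact: cauchy_cvg.
(* The first estimate puts [l] in [C]; combined with the second it gives [g l = w]. *)
have both e : 0 < e -> exists x, [/\ E x, `|l - x| < e & `|w - g x| < e].
  move=> e0; have Fe : F (ball l e) by apply: Fl; exact: nbhsx_ballx.
  have Fw : F (E `&` g @^-1` ball w e).
    by exists (ball w e) => //; exact: nbhsx_ballx.
  have [x [h1 [Ex h2]]] := filter_ex (filterI Fe Fw).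
  by exists x; move: h1 h2; rewrite /= -!ball_normE.
have Cl : C l.
  rewrite -EC; apply/closure_normP => e /both[x [Ex lx _]].
  by exists x.
exists l => //; apply/eqP; rewrite -subr_eq0 -normr_le0.
apply/ler_addgt0Pr => e e0; rewrite add0r.
have e20 : 0 < e / 2 by rewrite divr_gt0.
have [x [Ex lx wx]] := both _ e20.
rewrite -(subrKA (g x)) (le_trans (ler_normD _ _))// (splitr e) lerD//.
  by rewrite (closure_distance EC gc gl gi Cl (EsC _ Ex)) ltW.
by rewrite distrC ltW.
Qed.

(** * Inverses of partially defined maps *)

Lemma inv_onK (K : numFieldType) (V W : lmodType K) (D : set V) (f : V -> W)
    (x : V) :
  set_inj D f -> D x -> inv_on D f (f x) = x.
Proof. by move=> fi Dx; rewrite /inv_on pinvKV// inE. Qed.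

Lemma resolvent_set0_bij (K : numFieldType) (X : normedModType K) (D : set X)
    (A : X -> X) :
  resolvent_set D A 0 -> set_inj D A /\ set_surj D [set: X] A.
Proof.
move=> [[_ Ai As] _]; split=> [x y Dx Dy Axy|y _].
  by apply: Ai => //; rewrite !scale0r Axy.
have [x Dx] := As (- y) I.
by rewrite scale0r sub0r => /oppr_inj <-; exists x.
Qed.

(* X0u = closure D; Y1 and Y2 are the completions called X_{-1} and X_{-2}
   (underlined) in the text, with inclusions i1 : X0 -> Y1 and i2 : Y1 -> Y2. *)
Theorem proposition1p9 (K : numFieldType) (X0 : completeNormedModType K)
  (D : set X0) (A : X0 -> X0)
  (A_linear : linear_on D A)
  (A_resolvent : resolvent_set D A 0)
  (part_dense : closure D `<=` closure (part_dom D A (closure D)))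
  (Y1 : completeNormedModType K) (i1 : {linear X0 -> Y1})
  (Y1_completion : is_completion (fun x => `|inv_on D A x|) i1)
  (A1 : X0 -> Y1)
  (A1_extension : is_continuous_extension D (fun x => i1 (A x))
                    idfun (closure D) A1)
  (Y2 : completeNormedModType K) (i2 : {linear Y1 -> Y2})
  (Y2_completion :
     is_completion (fun y => `|i1 (inv_on (closure D) A1 y)|) i2)
  (A2 : Y1 -> Y2)
  (A2_extension : is_continuous_extension (closure D) (fun x => i2 (A1 x))
                    i1 [set: Y1] A2) :
  [/\ forall x, closure D x -> Am1 i1 A2 x = i2 (A1 x),
      is_Banach_space (Xm1 i1 A2) (norm_Xm1 i1 A2),
      forall y : Y1, Xm1 i1 A2 (i2 y) /\ norm_Xm1 i1 A2 (i2 y) = `|y|,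
      is_closed_subspace (Xm1 i1 A2) (norm_Xm1 i1 A2) (range i2) &
      is_isometric_isomorphism (Xm1 i1 A2) (norm_Xm1 i1 A2) (Am1 i1 A2)].
Proof.
set C := closure D in part_dense A1_extension Y2_completion A2_extension *.
have DC : D `<=` C := @subset_closure _ D.
have [A_inj A_surj] := resolvent_set0_bij A_resolvent.
have [[D0 D_lin] A_lin] := A_linear.
case: Y1_completion => i1_norm i1_dense.
have i1A_norm x : D x -> `|i1 (A x)| = `|x|.
  by move=> Dx; rewrite i1_norm inv_onK.
have A_lift y : exists2 x, D x & A x = y by have [x] := A_surj y I; exists x.
have i1_inj : set_inj [set: X0] i1.
  move=> x y _ _ /eqP; rewrite -subr_eq0 -linearB => /eqP.
  have [z Dz Az] := A_lift (x - y); rewrite -Az => /(congr1 Num.norm).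
  rewrite i1A_norm// normr0 => /eqP; rewrite normr_eq0 => /eqP z0.
  (* As [A] is linear on [D] only, [A 0 = 0] is read off from [0 = - z + z] with [z] in [D]. *)
  apply/eqP; rewrite -subr_eq0 -Az z0 -[X in A X](addNr z) -scaleN1r.
  by rewrite A_lin// scaleN1r addNr.
case: A1_extension => _ A1_cont A1_D.
have A1_lin0 : linear_on D A1.
  split=> // a x y Dx Dy.
  by rewrite !A1_D ?A_lin ?linearP//; exact: D_lin.
have A1_norm0 x : D x -> `|A1 x| = `|x|.
  by move=> Dx; rewrite A1_D// i1A_norm.
have A1_dense : dense (A1 @` D).
  (* Both sets are [i1 (A D)], since [A] maps [D] onto [X0]. *)
  suff -> : A1 @` D = range i1 by [].
  apply/seteqP; split=> _ [x Dx <-]; first by exists (A x); rewrite ?A1_D.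
  by have [z Dz <-] := A_lift x; exists z; rewrite ?A1_D.
have A1_lin := closure_linear_on erefl A1_cont A1_lin0 A1_norm0.
have A1_norm x : C x -> `|A1 x| = `|x|.
  exact: closure_isometry erefl A1_cont A1_lin0 A1_norm0 x.
have A1_inj : set_inj C A1.
  exact: closure_set_inj erefl A1_cont A1_lin0 A1_norm0.
have A1_surj : set_surj C [set: Y1] A1.
  exact: dense_isometry_surj erefl A1_cont A1_lin0 A1_norm0 A1_dense.
have [[C0 C_lin] A1_linE] := A1_lin.
case: Y2_completion => i2_norm _.
have i2A1_norm x : C x -> `|i2 (A1 x)| = `|i1 x|.
  by move=> Cx; rewrite i2_norm inv_onK.
case: A2_extension => _ A2_cont A2_C.
have E_dense : closure (i1 @` C) = [set: Y1].
  apply/seteqP; split=> // y _; apply/closure_normP => e e0.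
  have e20 : 0 < e / 2 by rewrite divr_gt0.
  have : closure (range i1) y by rewrite dense_closure.
  move=> /closure_normP/(_ _ e20)[_ [x _ <-] yx].
  have [z Dz Az] := A_lift x.
  (* The only use of the density of the domain of the part: [A z'] lies in [C], and [z - z'] stays
     in [D], where [i1 \o A] is isometric. *)
  have /part_dense/closure_normP/(_ _ e20)[z' [Dz' CAz'] zz'] := DC _ Dz.
  exists (i1 (A z')); first by exists (A z').
  have [Dzz' Azz'] := linear_onB A_linear Dz Dz'.
  rewrite -(subrKA (i1 x)) (le_lt_trans (ler_normD _ _))// (splitr e) ltrD//.
  by rewrite -Az -linearB -Azz' i1A_norm.
have A2_lin0 : linear_on (i1 @` C) A2.
  split.
    split; first by exists 0; rewrite ?linear0.
    move=> a _ _ [x Cx <-] [y Cy <-]; exists (a *: x + y); first exact: C_lin.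
    by rewrite linearP.
  move=> a _ _ [x Cx <-] [y Cy <-].
  rewrite -linearP !A2_C ?A1_linE ?linearP//; exact: C_lin.
have A2_norm0 y : (i1 @` C) y -> `|A2 y| = `|y|.
  by move=> [x Cx <-]; rewrite A2_C// i2A1_norm.
have [_ A2_lin] := closure_linear_on E_dense A2_cont A2_lin0 A2_norm0.
have A2_inj : set_inj [set: Y1] A2.
  exact: closure_set_inj E_dense A2_cont A2_lin0 A2_norm0.
have Am1_lin : linear (Am1 i1 A2).
  by move=> a x y; rewrite /Am1 linearP A2_lin.
(* Injectivity of [A2] and of [i1] cancels the two inverses, so that questions about the norm of
   [X_{-1}] reduce to [X0]. *)
have Am1_norm x : norm_Xm1 i1 A2 (Am1 i1 A2 x) = `|x|.
  by rewrite /norm_Xm1 /Am1 !inv_onK.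
have Am1_surj z : Xm1 i1 A2 z -> exists x, Am1 i1 A2 x = z.
  by move=> [_ [x _ <-] <-]; exists x.
have Am1_in x : Xm1 i1 A2 (Am1 i1 A2 x) by exists (i1 x) => //; exists x.
have i2_Am1 y : exists x, [/\ C x, i2 y = Am1 i1 A2 x & `|x| = `|y|].
  have [x Cx <-] := A1_surj y I.
  by exists x; split => //; [rewrite /Am1 A2_C | rewrite A1_norm].
have Am1Z a x : a *: Am1 i1 A2 x = Am1 i1 A2 (a *: x).
  have Am10 : Am1 i1 A2 0 = 0.
    by have := Am1_lin (-1) 0 0; rewrite !scaleN1r !addNr.
  by have := Am1_lin a x 0; rewrite Am10 !addr0.
have Am1D x y : Am1 i1 A2 x + Am1 i1 A2 y = Am1 i1 A2 (x + y).
  by have := Am1_lin 1 x y; rewrite !scale1r.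
have Am1B x y : Am1 i1 A2 x - Am1 i1 A2 y = Am1 i1 A2 (x - y).
  by rewrite -scaleN1r Am1Z Am1D scaleN1r.
have Am10 : Am1 i1 A2 0 = 0 by rewrite -(subrr 0) -Am1B subrr.
split.
- by move=> x Cx; rewrite /Am1 A2_C.
- split.
  + split; first by rewrite -Am10.
    by move=> a _ _ /Am1_surj[x <-] /Am1_surj[y <-]; rewrite Am1Z Am1D.
  + split.
    * by move=> _ /Am1_surj[x <-]; rewrite Am1_norm.
    * move=> _ /Am1_surj[x <-]; rewrite Am1_norm => /eqP.
      by rewrite normr_eq0 => /eqP ->.
    * by move=> a _ /Am1_surj[x <-]; rewrite Am1Z !Am1_norm normrZ.
    * move=> _ _ /Am1_surj[x <-] /Am1_surj[y <-].
      by rewrite Am1D !Am1_norm ler_normD.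
  + move=> F FF FX F_cauchy.
    (* Completeness is pulled back to [X0]: [G] is proper because [F] contains the image of [Am1],
       and Cauchy because [Am1] is isometric. *)
    pose G := filter_from F (fun P => Am1 i1 A2 @^-1` P).
    have FG P : G (Am1 i1 A2 @^-1` P) -> F P.
      move=> [Q FQ QP]; apply: filterS (filterI FQ FX) => z [Qz].
      by move=> /Am1_surj[x xz]; move: Qz; rewrite -xz; exact: QP.
    have GG : ProperFilter G.
      apply: filter_from_proper.
        apply: filter_from_filter; first by exists setT; exact: filterT.
        move=> P Q FP FQ; exists (P `&` Q); first exact: filterI.
        by [].
      move=> P FP; have [z [Pz /Am1_surj[x xz]]] := filter_ex (filterI FP FX).
      by exists x; rewrite /= xz.
    have Gc : cauchy G.
      apply: cauchy_exP => e e0.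
      have [_ /Am1_surj[x <-] Fx] := F_cauchy e e0.
      exists x; exists [set y | norm_Xm1 i1 A2 (Am1 i1 A2 x - y) < e] => //.
      by move=> y /=; rewrite Am1B Am1_norm -ball_normE.
    have [l Gl] : exists l : X0, G --> l by apply/cvg_ex; exact: cauchy_cvg.
    exists (Am1 i1 A2 l) => // e e0; apply: FG.
    have : G (ball l e) by apply: Gl; exact: nbhsx_ballx.
    by apply: filterS => y; rewrite -ball_normE /= Am1B Am1_norm.
- by move=> y; have [x [_ -> <-]] := i2_Am1 y.
- split.
  + split; first by exists 0; rewrite ?linear0.
    by move=> a _ _ [x _ <-] [y _ <-]; exists (a *: x + y); rewrite ?linearP.
  + by move=> _ [y _ <-]; have [x [_ -> _]] := i2_Am1 y.
  + move=> _ /Am1_surj[x <-] x_lim.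
    (* The range of [i2] is the image of [C] under [Am1], so its closedness is that of [C] in
       [X0]. *)
    suff Cx : C x by exists (A1 x); rewrite // /Am1 A2_C.
    apply: (@closed_closure _ D); apply/closure_normP => e /x_lim[_ [y _ <-]].
    have [x' [Cx' -> _]] := i2_Am1 y.
    by rewrite Am1B Am1_norm; exists x'.
- split=> //; split.
  + by move=> x _; exact: Am1_in.
  + by move=> x y _ _ /A2_inj h; apply: i1_inj; rewrite ?inE//;
      apply: h; rewrite inE.
  + by move=> z /Am1_surj[x <-]; exists x.
Qed.
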